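(* Let $k \geq 2$ be an integer. Let $q$ be a prime power such that $q \equiv 1 \pmod{k}$ if $q$ is even, or $q \equiv 1 \pmod{2k}$ if $q$ is odd. Let $\chi_k$ be a multiplicative character of $\mathbb{F}_q^*$ of order $k$. Then \[ \mathcal{K}_3(G_k(q)) = \frac{q(q-1)}{6k^3}\left(\mathbb{R}_k(q)+q-3k+1\right),\qquad\text{where } \mathbb{R}_k(q) := \sum_{\substack{s,t=1\\ s+t\not\equiv 0\ (k)}}^{k-1} J(\chi_k^s,\chi_k^t). \]
   Context: $\mathcal{K}_m(G)$ is the number of complete subgraphs of order $m$ in a graph $G$. For $k,q$ as in the claim, $S_k$ is the subgroup of $\mathbb{F}_q^*$ of order $\frac{q-1}{k}$ of $k$-th power residues, and the generalized Paley graph $G_k(q)$ has vertex set $\mathbb{F}_q$ with $ab$ an edge iff $a-b\in S_k$. Characters are extended by $\chi(0)=0$, and $J(A,B)=\sum_{a\in\mathbb{F}_q}A(a)B(1-a)$. *)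

(* Defs.v *)
From mathcomp Require Import all_boot all_order all_algebra.
From mathcomp Require Import all_fingroup all_solvable all_field all_character.

Set Implicit Arguments.
Unset Strict Implicit.
Unset Printing Implicit Defensive.

Import GroupScope GRing.Theory.
Local Open Scope ring_scope.

Definition num_complete_subgraphs (T : finType) (e : rel T) (m : nat) : nat :=
  #|[set A : {set T} | (#|A| == m) &&
      [forall x in A, forall y in A, (x != y) ==> e x y]]|.

Definition power_residues (F : finFieldType) (k : nat) : {set {unit F}} :=
  [set (u ^+ k)%g | u : {unit F}].

Definition paley_adj (F : finFieldType) (k : nat) : rel F :=
  fun a b => a - b \in [set val u | u in power_residues F k].

(* Multiplicative characters of F are the linear characters of the group of   *)
(* units {unit F}, extended by 0.  Powers of a character have to be taken     *)
(* before the extension, so that the trivial character also vanishes at 0.    *)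
Definition char_ext (F : finFieldType) (chi : 'CF([set: {unit F}])) (a : F) :
    algC :=
  if insub a is Some u then chi u else 0.

Definition jacobi_sum (F : finFieldType) (A B : 'CF([set: {unit F}])) : algC :=
  \sum_(a : F) char_ext A a * char_ext B (1 - a).

Definition jacobi_total (F : finFieldType) (k : nat)
    (chi : 'CF([set: {unit F}])) : algC :=
  \sum_(1 <= s < k) \sum_(1 <= t < k | ~~ (k %| s + t)%N)
     jacobi_sum (chi ^+ s) (chi ^+ t).

Lemma power_residues_group_set (F : finFieldType) (k : nat) :
  group_set (power_residues F k).
Proof.
apply/group_setP; split; first by apply/imsetP; exists 1%g; rewrite ?expg1n.
move=> _ _ /imsetP[x _ ->] /imsetP[y _ ->]; apply/imsetP; exists (x * y)%g => //.
by rewrite expgMn //; apply: val_inj; rewrite /= mulrC.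
Qed.

Canonical power_residues_group (F : finFieldType) (k : nat) :=
  Group (power_residues_group_set F k).

Lemma card_power_residues (F : finFieldType) (k : nat) :
  (k %| #|F|.-1)%N -> #|power_residues F k| = (#|F|.-1 %/ k)%N.
Proof.
rewrite -card_finField_unit => kF.
have /cyclicP[g Dg] := field_unit_group_cyclic [group of [set: {unit F}]].
rewrite /= in Dg.
have -> : power_residues F k = <[g ^+ k]>%g.
  apply/setP=> x; apply/imsetP/cycleP => [[u _ ->]|[i ->]].
    have /cycleP[i ->] : u \in <[g]>%g by rewrite -Dg inE.
    by exists i; rewrite -!expgM mulnC.
  by exists (g ^+ i)%g => //; rewrite -!expgM mulnC.
by move: kF; rewrite Dg => kF; rewrite -orderE orderXdiv.
Qed.

Lemma paley_adj_irr (F : finFieldType) (k : nat) : irreflexive (@paley_adj F k).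
Proof.
move=> a; apply/negbTE/imsetP => -[u _ /eqP]; rewrite subrr eq_sym.
by move/eqP=> u0; have := valP u; rewrite u0 unitr0.
Qed.

Lemma paley_adj_sym (F : finFieldType) (k : nat) :
  (~~ odd #|F| -> #|F| = 1 %[mod k]) -> (odd #|F| -> #|F| = 1 %[mod 2 * k]) ->
  symmetric (@paley_adj F k).
Proof.
move=> Fev Fodd.
have F0 : (0 < #|F|)%N by apply/card_gt0P; exists 0.
have kF : (k %| #|F|.-1)%N.
  rewrite -subn1 -eqn_mod_dvd //; case: (boolP (odd #|F|)) => oF.
    by apply/eqP; rewrite -[LHS](@modn_dvdm (2 * k)) ?dvdn_mull // (Fodd oF)
      modn_dvdm ?dvdn_mull.
  exact/eqP/Fev.
pose n1 : {unit F} := FinRing.unit F (unitrN1 F).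
have n1S : n1 \in power_residues F k.
  have -> : (n1 \in power_residues F k) = (<[n1]> \subset power_residues F k)%g.
    by rewrite cycle_subG.
  rewrite -(@cardSg_cyclic _ [group of [set: {unit F}]]) ?subsetT //=;
    last exact: field_unit_group_cyclic.
  rewrite card_power_residues // -orderE order_dvdn -val_eqE /= FinRing.val_unitX /=.
  case: (boolP (odd #|F|)) => oF.
    have /dvdnP[j Dj] : (2 * k %| #|F|.-1)%N.
      by rewrite -subn1 -eqn_mod_dvd //; apply/eqP/Fodd.
    have [k0|k0] := posnP k; first by rewrite k0 divn0.
    by rewrite Dj mulnA mulnK // mulnC exprM sqrrN expr1n expr1n.
  have -> : (-1 : F) = 1; last by rewrite expr1n.
  have : (-1 : F) ^+ #|F| = -1 by rewrite expf_card.
  by rewrite -signr_odd (negbTE oF) expr0 => <-.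
have sub (a b : F) : paley_adj k a b -> paley_adj k b a.
  case/imsetP=> u uS Du; apply/imsetP; exists (n1 * u)%g.
    exact: (@groupM _ (power_residues_group F k)).
  by rewrite /= mulN1r -Du opprB.
by move=> a b; apply/idP/idP; apply: sub.
Qed.

(* Main.v *)
(* Since S_k is a symmetric subgroup of the units, (x, u, a) |-> (x, x - u a,
   x - u), with u in S_k and a a common neighbour of 0 and 1, enumerates the
   ordered triangles: there are q (q - 1) / k N of them, N being the number of
   common neighbours of 0 and 1.  As S_k is the kernel of chi, the sum of chi^s
   over s < k is k times the indicator of S_k, so k^2 N is the sum of all
   J(chi^s, chi^t) with s, t < k.  The terms with s = 0, t = 0 or s + t = k are
   elementary: J(1, 1) = q - 2, and the others are -1 because chi(-1) = 1. *)
Require Import Defs.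
From mathcomp Require Import all_boot all_order all_algebra.
From mathcomp Require Import all_fingroup all_solvable all_field all_character.
From mathcomp Require Import ring zify.
Import GRing.Theory Num.Theory.
Local Open Scope ring_scope.

Set Implicit Arguments.
Unset Strict Implicit.

(** * Triangles as ordered tuples *)

(** Irreflexivity makes the entries of such a tuple distinct, so the tuples are fibred over their
    underlying sets, and the fibre over a clique consists of its [m]! orderings. *)
Lemma card_pairwise_tuples (T : finType) (e : rel T) (m : nat) :
  symmetric e -> irreflexive e ->
  #|[set t : m.-tuple T | pairwise e t]| = (num_complete_subgraphs e m * m`!)%N.
Proof.
(* Unlike [e], the clique relation [r] is reflexive, so for it [pairwise] agrees with the relation
   on all pairs. *)
move=> e_sym e_irr; pose r : rel T := fun x y => (x != y) ==> e x y.
have r_refl : reflexive r by move=> x; rewrite /r eqxx.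
have r_sym : symmetric r by move=> x y; rewrite /r e_sym eq_sym.
have pairwiseE (s : seq T) : pairwise e s = all2rel r s && uniq s.
  rewrite -pairwise_all2rel // uniq_pairwise -pairwise_relI.
  apply: eq_pairwise => x y /=; rewrite /r.
  by case: eqVneq => [->|]; rewrite ?e_irr ?andbT.
rewrite -sum1_card /num_complete_subgraphs; set K := [set A : {set T} | _].
have KP (A : {set T}) : reflect (#|A| = m /\ {in A &, forall x y, r x y}) (A \in K).
  rewrite inE; apply: (iffP andP) => -[/eqP Am Ar]; split; rewrite ?Am //.
    by move=> x y xA yA; move/forall_inP/(_ x xA)/forall_inP: Ar; apply.
  by apply/forall_inP=> x xA; apply/forall_inP=> y yA; apply: Ar.
rewrite (partition_big (fun t : m.-tuple T => [set x in t]) [in K]) /=; last first.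
  move=> t; rewrite inE pairwiseE => /andP[/allrelP tr /card_uniqP tm].
  by apply/KP; rewrite cardsE tm size_tuple; split=> // x y; rewrite !inE; apply: tr.
rewrite -sum_nat_const; apply: eq_bigr => A /KP[Am Ar].
transitivity #|[set t : m.-tuple T | all [in A] t & uniq t]|; last first.
  by rewrite card_uniq_tuples Am ffactnn.
rewrite sum1_card -[RHS]cardsE; apply: eq_card => t; rewrite unfold_in /= !inE pairwiseE.
apply/andP/andP=> -[].
  by case/andP=> _ -> /eqP <-; split=> //; apply/allP=> x; rewrite inE.
move=> /allP tA t_uniq; rewrite t_uniq andbT; split.
  by apply/allrelP=> x y /tA xA /tA yA; apply: Ar.
rewrite eqEcard cardsE Am (card_uniqP t_uniq) size_tuple leqnn andbT.
by apply/subsetP=> x; rewrite inE => /tA.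
Qed.

(** The differences within (x, x - u a, x - u) are u a, u and u (1 - a). Since S is a group and u is
    in S, all three lie in S exactly when a and 1 - a do. *)
Lemma card_paley_triples (F : finFieldType) (k : nat) :
  #|[set t : 3.-tuple F | pairwise (@paley_adj F k) t]| =
    (#|F| * #|power_residues F k| *
     #|[set a : F | paley_adj k 1%R a && paley_adj k a 0%R]|)%N.
Proof.
set S := power_residues F k; set N := [set a | _].
have SM u v : u \in S -> v \in S -> (u * v)%g \in S.
  exact: (@groupM _ (power_residues_group F k)).
have SV u : u \in S -> (u^-1)%g \in S.
  by move=> uS; rewrite (@groupV _ (power_residues_group F k)).
pose f (p : F * {unit F} * F) : 3.-tuple F :=
  [tuple p.1.1; p.1.1 - val p.1.2 * p.2; p.1.1 - val p.1.2].
have u0 (u : {unit F}) : val u != 0 by rewrite -unitfE (valP u).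
have uK (u v : {unit F}) : val u * val (u^-1 * v)%g = val v.
  by rewrite -FinRing.val_unitM mulgA mulgV mul1g.
have f_inj : injective f.
  move=> [[x u] a] [[y v] b] /(congr1 val)[/= <-{y}].
  move=> /addrI/oppr_inj E /addrI/oppr_inj/val_inj uv.
  by rewrite -uv in E *; rewrite (mulfI (u0 u) E).
rewrite -[#|F|]cardsT -!cardsX -(card_imset _ f_inj); apply: eq_card => t.
rewrite inE; apply/idP/imsetP.
  case/tupleP: t => x t; case/tupleP: t => y t; case/tupleP: t => z t.
  rewrite tuple0 /= !andbT.
  case/andP=> /andP[/imsetP[v vS Dv] /imsetP[u uS Du]] /imsetP[w wS Dw].
  (* From x - y = v, x - z = u and y - z = w one gets a = v / u and 1 - a = w / u. *)
  exists (x, u, val (u^-1 * v)%g); last first.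
    apply: val_inj; transitivity [:: x; x - val v; x - val u].
      by rewrite -Dv -Du !subKr.
    by rewrite -(uK u v).
  rewrite !inE uS /= /paley_adj subr0; apply/andP; split; last first.
    by apply: (imset_f val (x := (u^-1 * v)%g)); rewrite SM ?SV.
  apply/imsetP; exists (u^-1 * w)%g; first by rewrite SM ?SV.
  apply: (mulfI (u0 u)); rewrite mulrBr !uK mulr1 -Du -Dv -Dw.
  by rewrite addrC opprB addrA subrK.
case=> -[[x u] a]; rewrite !inE /= => /andP[uS /andP[/imsetP[w wS Dw]]].
case/imsetP=> v vS; rewrite subr0 => Da ->.
rewrite /= !andbT /paley_adj !subKr; apply/andP; split; last first.
  apply/imsetP; exists (u * w)%g; rewrite ?SM // FinRing.val_unitM -Dw mulrBr mulr1.
  by rewrite opprB addrC addrA subrK.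
by rewrite Da -FinRing.val_unitM; apply/andP; split; apply: imset_f; rewrite ?SM.
Qed.

(** * Extended characters and elementary Jacobi sums *)

Section Jacobi.
Variable F : finFieldType.
Implicit Types (A B : 'CF([set: {unit F}])) (u : {unit F}) (a b : F).

Lemma char_ext0 A : char_ext A 0 = 0.
Proof. by rewrite /char_ext insubN // unitr0. Qed.

Lemma char_ext_unit A u : char_ext A (val u) = A u.
Proof. by rewrite /char_ext valK. Qed.

Lemma finfield_unitP a : a != 0 -> {u : {unit F} | val u = a}.
Proof. by rewrite -unitfE => Ua; exists (FinRing.unit F Ua). Qed.

Lemma char_extM A a b : A \is a linear_char ->
  char_ext A (a * b) = char_ext A a * char_ext A b.
Proof.
move=> Alin; have [->|/finfield_unitP[u <-]] := eqVneq a 0.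
  by rewrite !(mul0r, char_ext0).
have [->|/finfield_unitP[v <-]] := eqVneq b 0; first by rewrite !(mulr0, char_ext0).
by rewrite -FinRing.val_unitM !char_ext_unit lin_charM ?inE.
Qed.

Lemma char_ext1 A : A \is a linear_char -> char_ext A 1 = 1.
Proof. by move=> Alin; rewrite -[1]/(val (1%g : {unit F})) char_ext_unit lin_char1. Qed.

Lemma char_ext_cfun1 a : char_ext (1 : 'CF([set: {unit F}])) a = (a != 0)%:R.
Proof.
have [->|a0] := eqVneq a 0; first by rewrite char_ext0.
by have [u <-] := finfield_unitP a0; rewrite char_ext_unit cfun1E inE.
Qed.

Lemma sum_char_ext_cfun1 : \sum_a char_ext (1 : 'CF([set: {unit F}])) a = #|F|%:R - 1.
Proof.
rewrite (eq_bigr _ (fun a _ => char_ext_cfun1 a)) -natr_sum.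
rewrite (cardD1 (0 : F)) inE natrD [_ + _ - _]addrAC subrr add0r -sum1_card big_mkcond.
by rewrite [in RHS]big_mkcond; congr (_%:R); apply: eq_bigr => a _;
   rewrite !inE andbT; case: eqP.
Qed.

(** Multiplication by a unit u with A(u) != 1 permutes the field, so the sum is fixed under
    multiplication by A(u). *)
Lemma sum_char_ext A : A \is a linear_char -> A != 1 -> \sum_a char_ext A a = 0.
Proof.
move=> Alin A1; have [u Au] : {u | A u != 1}.
  apply/sigW/existsP; apply: contraNT A1 => /existsPn Au; apply/eqP/cfun_inP => u _.
  by rewrite cfun1E inE; apply/eqP; rewrite -[_ == _]negbK Au.
have u0 : val u != 0 by rewrite -unitfE (valP u).
set s := \sum_a _; have : A u * s = s.
  rewrite /s mulr_sumr [RHS](reindex_inj (mulfI u0)).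
  by apply: eq_bigr => a _; rewrite char_extM // char_ext_unit.
move/eqP; rewrite -subr_eq0 -[X in _ - X]mul1r -mulrBl mulf_eq0 subr_eq0.
by rewrite (negbTE Au) => /eqP.
Qed.

Lemma jacobi_sumC A B : jacobi_sum A B = jacobi_sum B A.
Proof.
rewrite /jacobi_sum (reindex_inj (inv_inj (subKr 1))).
by apply: eq_bigr => a _; rewrite subKr mulrC.
Qed.

(** The extended trivial character vanishes only at 0, so just the term A(1) = 1 is lost. *)
Lemma jacobi_sum_cfun1r A : A \is a linear_char ->
  jacobi_sum A 1 = \sum_a char_ext A a - 1.
Proof.
move=> Alin; rewrite /jacobi_sum (bigD1 1) //= subrr char_ext0 mulr0 add0r.
rewrite [in RHS](bigD1 1) //= char_ext1 // [RHS]addrAC subrr add0r.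
by apply: eq_bigr => a a1; rewrite char_ext_cfun1 subr_eq0 eq_sym a1 mulr1.
Qed.

(** As B is the inverse of A, the summand is A(a / (1 - a)). For a != 1 the quotient takes every
    value except -1 once, and the full sum of A is 0. *)
Lemma jacobi_sum_inv A B : A \is a linear_char -> B \is a linear_char ->
  A * B = 1 -> A != 1 -> jacobi_sum A B = - char_ext A (-1).
Proof.
move=> Alin Blin AB1 A1.
have ABV a : char_ext B a = char_ext A a^-1.
  have [->|/finfield_unitP[u <-]] := eqVneq a 0; first by rewrite invr0 !char_ext0.
  rewrite -FinRing.val_unitV !char_ext_unit lin_charV ?inE //.
  have: (A * B) u = 1 by rewrite AB1 cfun1E inE.
  rewrite cfunE => ABu; apply: (mulfI (lin_char_neq0 Alin (in_setT u))).
  by rewrite ABu divff ?lin_char_neq0 ?inE.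
apply/eqP; rewrite -addr_eq0 -(sum_char_ext Alin A1).
rewrite [eqbRHS](bigD1 (-1)) //= [eqbLHS]addrC (inj_eq (addrI _)).
rewrite /jacobi_sum (bigD1 1) //= subrr ABV invr0 char_ext0 mulr0 add0r.
(* At a = 1 the quotient a / (1 - a) is 0 and the condition of the reindexed
   sum fails, so the junk value is harmless. *)
rewrite [eqbRHS](reindex_onto (fun a => a / (1 - a)) (fun b => b / (1 + b))).
  apply/eqP/eq_big => a; last by rewrite char_extM // ABV.
  have [->|a1] := eqVneq a 1.
    by rewrite subrr invr0 !mulr0 mul0r [0 == 1]eq_sym oner_eq0 andbF.
  have b0 : 1 - a != 0 by rewrite subr_eq0 eq_sym.
  have E : 1 + a / (1 - a) = (1 - a)^-1 by field.
  rewrite E invrK divfK // eqxx andbT -subr_eq0 opprK addrC E.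
  by rewrite invr_eq0 b0.
move=> b; rewrite -subr_eq0 opprK addrC => b0.
have E : 1 - b / (1 + b) = (1 + b)^-1 by field.
by rewrite E invrK divfK.
Qed.

(** * Power residues and the sum over all powers of the character *)

(** The units are generated by some g. If A(g^i) = 1 then A^i is trivial on every power of g, so the
    order of A divides i. *)
Lemma lin_char_kernel A u : A \is a linear_char ->
  (A u == 1) = (u \in power_residues F #[A]%CF).
Proof.
move=> Alin; set k := #[A]%CF; apply/idP/imsetP; last first.
  case=> v _ ->; rewrite lin_charX ?inE // -exp_cfunE ?inE //.
  by rewrite exp_cforder cfun1E inE.
have /cyclicP[g Dg] := field_unit_group_cyclic [group of [set: {unit F}]].
have gen v : exists i, v = (g ^+ i)%g.
  by apply/cycleP; rewrite -Dg inE.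
have [i ->] := gen u; rewrite lin_charX ?inE // => /eqP Ag1.
have /dvdnP[j ->] : (k %| i)%N.
  rewrite dvdn_cforder; apply/eqP/cfun_inP=> v _; have [n ->] := gen v.
  rewrite exp_cfunE ?inE // lin_charX ?inE // exprAC Ag1 expr1n.
  by rewrite cfun1E inE.
by exists (g ^+ j)%g; rewrite ?expgM.
Qed.

Lemma sum_char_ext_exp A (k := #[A]%CF) a b : A \is a linear_char ->
  \sum_(0 <= s < k) char_ext (A ^+ s) (a - b) = k%:R * (paley_adj k a b)%:R.
Proof.
(* At a = b every term vanishes, even for s = 0. Otherwise this is a geometric sum in A(u), whose
   [k]-th power is 1. *)
move=> Alin; have [ab0|/finfield_unitP[u Du]] := eqVneq (a - b) 0.
  rewrite (subr0_eq ab0) paley_adj_irr mulr0 subrr.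
  by apply: big1 => s _; rewrite char_ext0.
rewrite /paley_adj -Du mem_imset; last exact: val_inj.
rewrite -lin_char_kernel //.
under eq_bigr => s _ do rewrite char_ext_unit exp_cfunE ?inE //.
have [->|Au1] := eqVneq (A u) 1.
  by under eq_bigr => s _ do rewrite expr1n; rewrite sumr_const_nat subn0 mulr1.
have Auk : A u ^+ k = 1 by rewrite -exp_cfunE ?inE // exp_cforder cfun1E inE.
apply/eqP; have /esym/eqP := subrX1 (A u) k.
by rewrite Auk subrr mulf_eq0 subr_eq0 (negbTE Au1) big_mkord mulr0.
Qed.

Lemma card_paley_jacobi A (k := #[A]%CF) : A \is a linear_char ->
  k%:R ^+ 2 * #|[set a : F | paley_adj k 1 a && paley_adj k a 0]|%:R =
    \sum_(0 <= s < k) \sum_(0 <= t < k) jacobi_sum (A ^+ s) (A ^+ t).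
Proof.
move=> Alin; rewrite -sum1_card big_mkcond natr_sum mulr_sumr.
transitivity (\sum_(a : F) \sum_(0 <= s < k) \sum_(0 <= t < k)
    char_ext (A ^+ s) a * char_ext (A ^+ t) (1 - a)); last first.
  by rewrite exchange_big; apply: eq_bigr => s _; rewrite exchange_big.
apply: eq_bigr => a _; rewrite -big_distrlr /=.
have := sum_char_ext_exp a 0 Alin; rewrite subr0 => ->.
rewrite sum_char_ext_exp // inE.
by case: (paley_adj k 1 a); case: (paley_adj k a 0); rewrite /= ?(mulr0, mul0r, mulr1).
Qed.

(** The pair (0, 0) gives q - 2. The 2 (k - 1) pairs with one zero index and the k - 1 pairs with s
    + t = k give -1 each: in total q - 3 k + 1. *)
Lemma sum_jacobi_sum A (k := #[A]%CF) : A \is a linear_char -> (1 < k)%N ->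
    char_ext A (-1) = 1 ->
  \sum_(0 <= s < k) \sum_(0 <= t < k) jacobi_sum (A ^+ s) (A ^+ t) =
    jacobi_total k A + #|F|%:R - 3%:R * k%:R + 1.
Proof.
move=> Alin k1 AN1; have k0 := ltnW k1.
have lin s : A ^+ s \is a linear_char by rewrite rpredX.
have neq1 s : (0 < s < k)%N -> A ^+ s != 1.
  by case/andP=> s0 sk; rewrite -dvdn_cforder gtnNdvd.
have J0 s : (0 < s < k)%N -> jacobi_sum (A ^+ s) (A ^+ 0) = -1.
  by move=> sk; rewrite expr0 jacobi_sum_cfun1r // sum_char_ext ?neq1 // sub0r.
have AsN1 s : char_ext (A ^+ s) (-1) = 1.
  move: AN1; rewrite -[-1]/(val (FinRing.unit F (unitrN1 F))) !char_ext_unit => AN1.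
  by rewrite exp_cfunE ?inE // AN1 expr1n.
have Jinv s : (0 < s < k)%N ->
    \sum_(1 <= t < k | (k %| s + t)%N) jacobi_sum (A ^+ s) (A ^+ t) = -1.
  move=> sk; have [s0 s_lt] := andP sk; have s_le := ltnW s_lt.
  (* Since 0 < s + t < 2 k, the only index left is t = k - s. *)
  rewrite (@congr_big_nat _ _ _ 1 k 1 k _ (pred1 (k - s)%N) _
             (fun t => jacobi_sum (A ^+ s) (A ^+ t))) => // [|t tk]; last first.
    apply/dvdnP/eqP => [[[|[|j]] Dj]|->]; try nia.
    by exists 1%N; lia.
  rewrite big_nat1_eq ifT; last by lia.
  by rewrite jacobi_sum_inv ?lin ?neq1 ?AsN1 // -exprD subnKC // exp_cforder.
have J00 : jacobi_sum (A ^+ 0) (A ^+ 0) = #|F|%:R - 1 - 1.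
  by rewrite expr0 jacobi_sum_cfun1r ?rpred1 // sum_char_ext_cfun1.
rewrite big_ltn // [X in X + _](big_ltn k0) J00.
rewrite (@eq_big_nat _ _ _ _ _ _ (fun=> -1)) => [|t tk]; last by rewrite jacobi_sumC J0.
(* In each row s > 0 the -2 collects t = 0 and t = k - s. *)
rewrite sumr_const_nat [X in _ + X](@eq_big_nat _ _ _ _ _ _ (fun s => -2 +
   \sum_(1 <= t < k | ~~ (k %| s + t)%N) jacobi_sum (A ^+ s) (A ^+ t))) => [|s sk].
  rewrite big_split /= sumr_const_nat /jacobi_total.
  rewrite -[-1 *+ _]mulr_natr -[-2 *+ _]mulr_natr natrB //.
  by ring.
rewrite big_ltn // J0 // (bigID (fun t => k %| s + t)%N) /= Jinv // addrA.
by congr (_ + _); ring.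
Qed.

End Jacobi.

Unset Implicit Arguments.

Theorem theorem2p9 (k q : nat) (F : finFieldType)
    (chi : 'CF([set: {unit F}]))
    (hk : (2 <= k)%N)
    (hF : #|F| = q)
    (hq_even : ~~ odd q -> q = 1 %[mod k])
    (hq_odd : odd q -> q = 1 %[mod 2 * k])
    (hchi : chi \is a linear_char)
    (hchi_order : #[chi]%CF = k) :
  (num_complete_subgraphs (@paley_adj F k) 3)%:R =
    q%:R * (q%:R - 1) / (6%:R * k%:R ^+ 3) *
      (jacobi_total k chi + q%:R - 3%:R * k%:R + 1) :> algC.
Proof.
have F0 : (0 < #|F|)%N by apply/card_gt0P; exists 0.
have e_sym : symmetric (@paley_adj F k) by apply: paley_adj_sym; rewrite hF.
have k0 : k%:R != 0 :> algC by rewrite pnatr_eq0 -lt0n ltnW.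
(* The (q - 1)-th power of every unit is 1, so the order of [chi] divides q - 1. *)
have kF : (k %| #|F|.-1)%N.
  rewrite -card_finField_unit -hchi_order dvdn_cforder; apply/eqP/cfun_inP=> u _.
  rewrite exp_cfunE ?inE // -lin_charX ?inE // cfun1E inE.
  by rewrite expg_cardG ?inE // lin_char1.
have SE : #|power_residues F k|%:R = (q%:R - 1) / k%:R :> algC.
  rewrite card_power_residues // natf_div // -hF -[in RHS](prednK F0).
  by rewrite -natr1 addrK.
(* 1 is adjacent to 0, so by symmetry -1 lies in S, the kernel of [chi]. *)
have chiN1 : char_ext chi (-1) = 1.
  have : paley_adj k (0 : F) 1.
    rewrite e_sym /paley_adj subr0; apply/imsetP.
    by exists 1%g; rewrite ?(group1 (power_residues_group F k)).
  rewrite /paley_adj sub0r => /imsetP[u uS ->].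
  by apply/eqP; rewrite char_ext_unit lin_char_kernel // hchi_order.
have := card_paley_jacobi hchi; rewrite sum_jacobi_sum ?hchi_order // hF => <-.
(* The 6 is the number of orderings of a triangle; k^3 is k^2 from the Jacobi sums times k from the
   order of S. *)
apply: (@mulIf _ 3`!%:R); first by rewrite pnatr_eq0.
rewrite -natrM -card_pairwise_tuples //; last exact: paley_adj_irr.
rewrite card_paley_triples !natrM hF SE.
by field; rewrite k0.
Qed.
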